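(* Let $\mathfrak{g}$ be a $7$-dimensional Lie algebra. If there are non-zero vectors $X$ and $Y$ in $\mathfrak{g}$ such that $(\iota_X\iota_Y\kappa)^2=0$ for every closed $4$-form $\kappa$ on $\mathfrak{g}$, then $\mathfrak{g}$ does not admit coclosed $\mathrm{G}_2$-structures.
   Context: Lie algebras are real. $d$ denotes the Chevalley–Eilenberg differential of $\mathfrak{g}$; a $4$-form $\kappa\in\Lambda^4(\mathfrak{g}^* )$ is closed if $d\kappa=0$; $\iota_X$ is contraction by $X$; for a $2$-form $\beta$, $\beta^2=\beta\wedge\beta$; $e^{ijk}=e^i\wedge e^j\wedge e^k$, etc. A $\mathrm{G}_2$-structure on $\mathfrak{g}$ is a positive $3$-form $\varphi\in\Lambda^3(\mathfrak{g}^* )$, i.e. one for which there is a coframe $\{e^1,\dots,e^7\}$ of $\mathfrak{g}^*$ with $\varphi=e^{127}+e^{347}+e^{567}+e^{135}-e^{146}-e^{236}-e^{245}$. It determines the inner product making $\{e^i\}$ orthonormal and the orientation $e^{1\cdots7}$, and its Hodge dual is $\phi=\star_\varphi\varphi=e^{1234}+e^{1256}+e^{1367}+e^{1457}+e^{2357}-e^{2467}+e^{3456}$. The $\mathrm{G}_2$-structure is coclosed if $d\phi=0$.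
   Formalization: The vectors X and Y are required to be linearly independent, not merely non-zero: for proportional X and Y the contraction vanishes identically, and the claim fails, e.g. for the abelian Lie algebra with X = Y. *)

(* Defs.v *)
(* MathComp world: finite-dimensional spaces from mathcomp-algebra, reals from
   mathcomp-analysis. *)
From mathcomp Require Import all_boot all_order all_algebra all_fingroup.
From mathcomp Require Import all_classical all_reals.

Set Implicit Arguments.
Unset Strict Implicit.
Unset Printing Implicit Defensive.

Import Order.TTheory GRing.Theory Num.Theory.
Local Open Scope ring_scope.

Record is_lie_bracket (R : realType) (V : vectType R) (br : V -> V -> V) :
    Prop := IsLieBracket {
  lie_linear_l : forall y, linear (br^~ y);
  lie_linear_r : forall x, linear (br x);
  lie_alternating : forall x, br x x = 0;
  lie_jacobi : forall x y z, br x (br y z) + br y (br z x) + br z (br x y) = 0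
}.

(* Raw k-ary functions; the elements of the k-th exterior power of the dual of V are those satisfying
   [is_form]. Addition, opposite and 0 are pointwise. *)
Definition kfun (R : realType) (V : vectType R) (k : nat) : Type :=
  ('I_k -> V) -> R.

Record is_form (R : realType) (V : vectType R) (k : nat) (f : kfun V k) :
    Prop := IsForm {
  form_multilinear : forall (i : 'I_k) (v : 'I_k -> V) (a : R) (x y : V),
    f (dfwith v i (a *: x + y)) = a * f (dfwith v i x) + f (dfwith v i y);
  form_alternating : forall (v : 'I_k -> V) (i j : 'I_k),
    i != j -> v i = v j -> f v = 0
}.

Definition vcons (T : Type) (k : nat) (x : T) (v : 'I_k -> T) : 'I_k.+1 -> T :=
  fun i => if unlift ord0 i is Some j then v j else x.

Definition vcat (T : Type) (k l : nat) (u : 'I_k -> T) (v : 'I_l -> T) :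
    'I_(k + l) -> T :=
  fun i => match fintype.split i with inl a => u a | inr b => v b end.

Definition contract_by (R : realType) (V : vectType R) (k : nat) (X : V)
    (f : kfun V k.+1) : kfun V k :=
  fun v => f (vcons X v).

(* Normalised so that (a /\ b)(x, y) = a x * b y - a y * b x on 1-forms. *)
Definition wedge_prod (R : realType) (V : vectType R) (k l : nat)
    (f : kfun V k) (h : kfun V l) : kfun V (k + l) :=
  fun v => (k`! * l`!)%:R^-1 *
    \sum_(s : 'S_(k + l)) (-1) ^+ s *
      f (fun a => v (s (lshift l a))) * h (fun b => v (s (rshift k b))).

(* Chevalley-Eilenberg differential (trivial coefficients) in degree >= 1:
     sum over p < q of (-1)^(p+q) f([v_p, v_q], v_0, .. ^v_p .. ^v_q .., v_k.+1).
   The pair p < q is encoded as p = i and q = lift i j, with i <= j. *)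
Definition ce_diff (R : realType) (V : vectType R) (br : V -> V -> V) (k : nat)
    (f : kfun V k.+1) : kfun V k.+2 :=
  fun v => \sum_(i < k.+2) \sum_(j < k.+1 | (i <= j)%N)
    (-1) ^+ (i + lift i j) *
      f (vcons (br (v i) (v (lift i j))) (fun m => v (lift i (lift j m)))).

Definition closed_form (R : realType) (V : vectType R) (br : V -> V -> V)
    (k : nat) (f : kfun V k.+1) : Prop :=
  ce_diff br f = 0.

(* [coform e i] is e^i with the 1-based numbering of the literature. *)
Definition coform (R : realType) (V : vectType R) (n : nat)
    (e : n.-tuple 'Hom(V, R^o)) (i : nat) : kfun V 1 :=
  fun v => e`_i.-1 (v ord0).

(* [ewedge e [:: i; j; ...]] is e^{ij...} = e^i /\ e^j /\ ... *)
Fixpoint ewedge (R : realType) (V : vectType R) (n : nat)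
    (e : n.-tuple 'Hom(V, R^o)) (s : seq nat) : kfun V (size s) :=
  match s with
  | [::] => fun=> 1
  | i :: s' => wedge_prod (coform e i) (@ewedge R V n e s')
  end.
Arguments ewedge {R V n} e s _.

Definition g2_model (R : realType) (V : vectType R)
    (e : 7.-tuple 'Hom(V, R^o)) : kfun V 3 :=
  ewedge e [:: 1; 2; 7] + ewedge e [:: 3; 4; 7] + ewedge e [:: 5; 6; 7]
  + ewedge e [:: 1; 3; 5] - ewedge e [:: 1; 4; 6] - ewedge e [:: 2; 3; 6]
  - ewedge e [:: 2; 4; 5].

Definition adapted_coframe (R : realType) (V : vectType R) (phi : kfun V 3)
    (e : 7.-tuple 'Hom(V, R^o)) : Prop :=
  basis_of fullv e /\ phi = g2_model e.

Definition is_G2_structure (R : realType) (V : vectType R) (phi : kfun V 3) :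
    Prop :=
  exists e, adapted_coframe phi e.

Definition dual_frame (R : realType) (V : vectType R) (n : nat)
    (e : n.-tuple 'Hom(V, R^o)) (E : 'I_n -> V) : Prop :=
  forall i j : 'I_n, tnth e i (E j) = (i == j)%:R.

(* Hodge star of the inner product with orthonormal frame E and volume form
   vol, in components:
     (star f)(w) = 1/k! sum_{i_1 .. i_k} f(E_{i_1} .. E_{i_k})
                                    vol(E_{i_1} .. E_{i_k}, w). *)
Definition hodge_star (R : realType) (V : vectType R) (k l : nat)
    (E : 'I_(k + l) -> V) (vol : kfun V (k + l)) (f : kfun V k) : kfun V l :=
  fun w => k`!%:R^-1 *
    \sum_(I : {ffun 'I_k -> 'I_(k + l)})
      f (fun a => E (I a)) * vol (vcat (fun a => E (I a)) w).

(* The inner product and orientation determined by phi are those for which an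
   adapted coframe e is orthonormal and positive: the dual frame is then
   orthonormal and the volume form is e^{1..7}. They do not depend on e. *)
Definition coclosed (R : realType) (V : vectType R) (br : V -> V -> V)
    (phi : kfun V 3) : Prop :=
  exists (e : 7.-tuple 'Hom(V, R^o)) (E : 'I_7 -> V),
    [/\ adapted_coframe phi e, dual_frame e E
      & closed_form br
          (hodge_star (k := 3) (l := 4) E (ewedge e [:: 1; 2; 3; 4; 5; 6; 7]) phi)].

(* Main.v *)
Require Import Defs.
From mathcomp Require Import all_boot all_order all_algebra all_fingroup.
From mathcomp Require Import all_classical all_reals.
From mathcomp Require Import zify ring.

Set Implicit Arguments.
Unset Strict Implicit.
Unset Printing Implicit Defensive.

Import Order.TTheory GRing.Theory Num.Theory.
Local Open Scope ring_scope.

(* Write *phi for the dual 4-form of a G2-structure phi and set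
   beta = i_X i_Y *phi. Then <beta ^ beta, *phi> = 2 |X ^ Y|^2: G2 acts
   transitively on orthonormal pairs, and for the pair (e_1, e_2) one has
   beta = +-(e^{34} + e^{56}), so beta^2 = 2 e^{3456}. Here the identity is
   checked in an adapted coframe, as an equality of polynomials in the
   coordinates of X and Y. If phi is coclosed, the hypothesis applies to *phi
   and gives beta^2 = 0, hence |X ^ Y|^2 = 0 and X, Y are linearly dependent. *)

(** * Alternating sums and determinants *)

(** A permutation amounts to the image of 0 and a permutation of the other points: [lift_perm ord0]
    is injective between sets of size $(n+1)!$. *)
Lemma sum_lift_perm (A : nmodType) (n : nat) (F : 'S_n.+1 -> A) :
  \sum_(s : 'S_n.+1) F s
  = \sum_(j < n.+1) \sum_(t : 'S_n) F (lift_perm ord0 j t).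
Proof.
rewrite pair_big.
rewrite (reindex (fun p : 'I_n.+1 * 'S_n => lift_perm ord0 p.1 p.2)) //=.
apply/onW_bij/inj_card_bij; last first.
  by rewrite card_prod !card_Sn card_ord factS.
move=> [j t] [j' t'] /permP /= eq_tt'.
have eqj : j = j' by move: (eq_tt' ord0); rewrite !lift_perm_id.
subst j'; congr (_, _); apply/permP => k.
by move: (eq_tt' (lift ord0 k)); rewrite !lift_perm_lift => /lift_inj.
Qed.

(** Unnormalised antisymmetrisation; up to its factorials, [wedge_prod] is the case where [G] is a
    tensor product. *)
Definition alt_sum (A : pzRingType) (T : Type) (n : nat)
    (G : ('I_n -> T) -> A) (v : 'I_n -> T) : A :=
  \sum_(s : 'S_n) (-1) ^+ s * G (v \o s).

(** The analogue of expansion along a first row: [lift_perm ord0 j t] has sign $(-1)^j$ times that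
    of [t]. *)
Lemma alt_sum_recl (A : pzRingType) (T : Type) (n : nat)
    (G : ('I_n.+1 -> T) -> A) (v : 'I_n.+1 -> T) :
  alt_sum G v = \sum_(j < n.+1)
    (-1) ^+ j * alt_sum (fun u => G (vcons (v j) u)) (v \o lift j).
Proof.
rewrite /alt_sum sum_lift_perm; apply: eq_bigr => j _.
rewrite mulr_sumr; apply: eq_bigr => t _.
rewrite mulrA odd_lift_perm /= signr_addb signr_odd; congr (_ * G _).
apply/funext => i; rewrite /vcons /=.
by case: unliftP => [k|] ->; rewrite ?lift_perm_lift ?lift_perm_id.
Qed.

Lemma alt_sum0 (A : pzRingType) (T : Type) (G : ('I_0 -> T) -> A)
    (v : 'I_0 -> T) : alt_sum G v = G v.
Proof.
rewrite /alt_sum (big_pred1 1%g) => [|s]; last first.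
  by apply/esym/eqP/permP => -[].
by rewrite odd_perm1 mul1r; congr G; apply/funext => -[].
Qed.

(** Entries are indexed by [nat], so that deleting a column is precomposition with [bump]. *)
Definition det_rows (A : pzRingType) (n : nat) (r : nat -> nat -> A) : A :=
  \det (\matrix_(i < n, j < n) r i j).

Lemma det_rowsS (A : comPzRingType) (n : nat) (r : nat -> nat -> A) :
  det_rows n.+1 r = \sum_(j < n.+1)
    (-1) ^+ j * r 0%N j * det_rows n (fun i k => r i.+1 (bump j k)).
Proof.
rewrite /det_rows (expand_det_row _ ord0); apply: eq_bigr => j _.
rewrite mxE /cofactor add0n mulrA [r _ _ * _]mulrC; congr (_ * \det _).
by apply/matrixP => i k; rewrite !mxE.
Qed.

Lemma det_rows0 (A : comPzRingType) (r : nat -> nat -> A) : det_rows 0 r = 1.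
Proof. exact: det_mx00. Qed.

Lemma det_rows_delta (A : comPzRingType) (n a : nat) (r : nat -> nat -> A) :
  (a <= n)%N -> (forall j, r 0%N j = (j == a)%:R) ->
  det_rows n.+1 r = (-1) ^+ a * det_rows n (fun i k => r i.+1 (bump a k)).
Proof.
move=> le_an r0; rewrite det_rowsS (bigD1 (Ordinal (le_an : a < n.+1)%N)) //=.
rewrite r0 eqxx mulr1 big1 ?addr0 // => j; rewrite -val_eqE /= r0 => /negPf ->.
by rewrite mulr0 mul0r.
Qed.

(** Nested cofactor expansion: [m2] gives the minors of the last two rows, [m3] those of the last
    three. *)
Lemma det_rows4 (A : comNzRingType) (r : nat -> nat -> A) :
  let m2 j k := r 2%N j * r 3%N k - r 2%N k * r 3%N j in
  let m3 j k l := r 1%N j * m2 k l - r 1%N k * m2 j l + r 1%N l * m2 j k in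
  det_rows 4 r = r 0%N 0%N * m3 1%N 2%N 3%N - r 0%N 1%N * m3 0%N 2%N 3%N
    + r 0%N 2%N * m3 0%N 1%N 3%N - r 0%N 3%N * m3 0%N 1%N 2%N.
Proof.
by rewrite /= !(det_rowsS, big_ord_recl, big_ord0, det_rows0) /bump /=; ring.
Qed.

Lemma det_col_perm (A : comPzRingType) (n : nat) (s : 'S_n) (M : 'M[A]_n) :
  \det (col_perm s M) = (-1) ^+ s * \det M.
Proof. by rewrite col_permE det_mulmx det_perm odd_permV mulrC. Qed.

Lemma vcons_nth (T : Type) (x0 x : T) (s : seq T) (n : nat) :
  vcons x (fun i : 'I_n => nth x0 s i) = fun i : 'I_n.+1 => nth x0 (x :: s) i.
Proof. by apply/funext => i; rewrite /vcons; case: unliftP => [j|] ->. Qed.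

Lemma alt_sum_nth (A : pzRingType) (T : Type) (n : nat)
    (G : ('I_n.+1 -> T) -> A) (v : nat -> T) :
  alt_sum G (v \o @nat_of_ord _) = \sum_(j < n.+1)
    (-1) ^+ j * alt_sum (fun u => G (vcons (v j) u))
                  ((v \o bump j) \o @nat_of_ord _).
Proof. exact: alt_sum_recl. Qed.

(** * The dual 4-form in coordinates *)

(* The 4-form dual to the model 3-form, e^{1234} + e^{1256} + e^{1367} + e^{1457}
   + e^{2357} - e^{2467} + e^{3456}, with indices shifted to start at 0; [q i j k l]
   stands for e^{ijkl} itself, for its value on four vectors, or for the
   component of a 4-form to be paired with it. *)
Definition g2_dual_sum (A : zmodType) (q : nat -> nat -> nat -> nat -> A) : A :=
  q 0%N 1%N 2%N 3%N + q 0%N 1%N 4%N 5%N + q 0%N 2%N 5%N 6%N + q 0%N 3%N 4%N 6%N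
  + q 1%N 2%N 4%N 6%N - q 1%N 3%N 5%N 6%N + q 2%N 3%N 4%N 5%N.

Definition bivector (A : pzRingType) (x y : nat -> A) (i j : nat) : A :=
  x i * y j - x j * y i.

(** The sum over (2,2)-shuffles; for two bivectors it is the Laplace expansion of a 4 by 4 minor
    along pairs of rows. *)
Definition wedge22 (A : pzRingType) (m n : nat -> nat -> A) (i j k l : nat) : A :=
  m i j * n k l - m i k * n j l + m i l * n j k
  + m j k * n i l - m j l * n i k + m k l * n i j.

(** For antisymmetric [b], half of a component of $b\wedge b$. *)
Definition pfaffian4 (A : pzRingType) (b : nat -> nat -> A) (i j k l : nat) : A :=
  b i j * b k l - b i k * b j l + b i l * b j k.

(* If beta is the contraction of the dual 4-form with x and y, this is
   <beta ^ beta, dual form> = 2 |x ^ y|^2 (each pair i < j occurs twice on the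
   right-hand side). *)
Lemma g2_dual_pfaffian (A : comNzRingType) (x y : nat -> A)
    (b : nat -> nat -> A) :
  (forall c d, (c < 7)%N -> (d < 7)%N -> b c d = g2_dual_sum (wedge22
    (bivector x y) (bivector (fun i => (i == c)%:R) (fun i => (i == d)%:R)))) ->
  2 * g2_dual_sum (pfaffian4 b)
  = \sum_(i < 7) \sum_(j < 7) bivector x y i j ^+ 2.
Proof.
set m := bivector x y => bE.
(* Each pair {c, d} lies in exactly two of the seven index quadruples. *)
have b0 :
  (b 0%N 1%N = m 2%N 3%N + m 4%N 5%N) *
  (b 0%N 2%N = - m 1%N 3%N + m 5%N 6%N) *
  (b 0%N 3%N = m 1%N 2%N + m 4%N 6%N) *
  (b 0%N 4%N = - m 1%N 5%N - m 3%N 6%N) *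
  (b 0%N 5%N = m 1%N 4%N - m 2%N 6%N) *
  (b 0%N 6%N = m 2%N 5%N + m 3%N 4%N) *
  (b 1%N 2%N = m 0%N 3%N + m 4%N 6%N) *
  (b 1%N 3%N = - m 0%N 2%N - m 5%N 6%N) *
  (b 1%N 4%N = m 0%N 5%N - m 2%N 6%N) *
  (b 1%N 5%N = - m 0%N 4%N + m 3%N 6%N) *
  (b 1%N 6%N = m 2%N 4%N - m 3%N 5%N) *
  (b 2%N 3%N = m 0%N 1%N + m 4%N 5%N) *
  (b 2%N 4%N = m 1%N 6%N - m 3%N 5%N) *
  (b 2%N 5%N = m 0%N 6%N + m 3%N 4%N) *
  (b 2%N 6%N = - m 0%N 5%N - m 1%N 4%N) *
  (b 3%N 4%N = m 0%N 6%N + m 2%N 5%N) *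
  (b 3%N 5%N = - m 1%N 6%N - m 2%N 4%N) *
  (b 3%N 6%N = - m 0%N 4%N + m 1%N 5%N) *
  (b 4%N 5%N = m 0%N 1%N + m 2%N 3%N) *
  (b 4%N 6%N = m 0%N 3%N + m 1%N 2%N) *
  (b 5%N 6%N = m 0%N 2%N - m 1%N 3%N).
  by do !apply: pair; rewrite bE // /g2_dual_sum /wedge22 /bivector /=; ring.
rewrite /g2_dual_sum /pfaffian4 !b0 !big_ord_recl !big_ord0 /bump /=.
by rewrite /m /bivector; ring.
Qed.

(** * Exterior monomials as determinants *)

Section Forms.
Variables (R : realType) (V : vectType R).

Definition det_form (n : nat) (e : 'I_n -> 'Hom(V, R^o)) : kfun V n :=
  fun v => \det (\matrix_(i, j) e i (v j) : 'M[R]_n).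

Lemma det_form_is_form (n : nat) (e : 'I_n -> 'Hom(V, R^o)) : is_form (det_form e).
Proof.
rewrite /det_form; split=> [i v a x y|v i j ij vij].
  (* Transposing turns the arguments of the form into rows, to which [determinant_multilinear]
     applies. *)
  rewrite -det_tr -[X in a * X]det_tr -[X in a * _ + X]det_tr -[X in a * _ + X]mul1r.
  apply: (determinant_multilinear (i0 := i)).
  - by apply/rowP => k; rewrite !mxE !dfwithin linearP mul1r.
  - by apply/matrixP => k l; rewrite !mxE !dfwithout ?neq_lift // eq_sym neq_lift.
  - by apply/matrixP => k l; rewrite !mxE !dfwithout ?neq_lift // eq_sym neq_lift.
rewrite -det_tr; apply: (determinant_alternate ij) => k.
by rewrite !mxE vij.
Qed.

Lemma is_formD (k : nat) (f h : kfun V k) :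
  is_form f -> is_form h -> is_form (f + h).
Proof.
move=> [fl fa] [hl ha]; split=> [i v a x y|v i j ij vij].
  by rewrite !fctE fl hl; ring.
by rewrite !fctE (fa _ _ _ ij vij) (ha _ _ _ ij vij) addr0.
Qed.

Lemma is_formN (k : nat) (f : kfun V k) : is_form f -> is_form (- f).
Proof.
move=> [fl fa]; split=> [i v a x y|v i j ij vij].
  by rewrite !fctE fl; ring.
by rewrite !fctE (fa _ _ _ ij vij) oppr0.
Qed.

(** Grouping permutations by the image of 0 gives the expansion along the first row; those with the
    same image all contribute the same minor, and their number cancels the factorial. *)
Lemma ewedgeE (n : nat) (e : n.-tuple 'Hom(V, R^o)) (s : seq nat) :
  ewedge e s = det_form (fun i => e`_(nth 0%N s i).-1).
Proof.
elim: s => [|a s IH]; apply/funext => v /=; first by rewrite /det_form det_mx00.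
have facN0 : (size s)`!%:R != 0 :> R by rewrite pnatr_eq0 -lt0n fact_gt0.
rewrite /wedge_prod (_ : 1`! = 1%N) // mul1n.
rewrite -[\sum_s _](_ : alt_sum (fun u : 'I_(size s).+1 -> V =>
  coform e a (fun=> u ord0) * ewedge e s (u \o lift ord0)) v = _); last first.
  apply: eq_bigr => t _; rewrite mulrA /coform;
    congr (_ * e`__ (v (t _)) * ewedge e s _).
    by apply/val_inj.
  by apply/funext => i; congr (v (t _)); apply/val_inj.
rewrite alt_sum_recl /det_form (expand_det_row _ ord0) mulr_sumr.
apply: eq_bigr => j _; rewrite mxE /cofactor add0n /=.
rewrite mulrCA [RHS]mulrCA; congr (_ * _).
pose D := \det (\matrix_(i < size s, k < size s)
  e`_(nth 0%N s i).-1 (v (lift j k)) : 'M[R]_(size s)).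
rewrite /alt_sum (eq_bigr (fun=> e`_a.-1 (v j) * D)) => [|t _]; last first.
  rewrite /coform /vcons unlift_none mulrCA; congr (_ * _).
  rewrite IH /det_form -[D](signrMK t); congr (_ * _); rewrite -det_col_perm.
  congr (\det _); apply/matrixP => i k; rewrite !mxE /=.
  by case: unliftP => [l /lift_inj ->|/eqP] //; rewrite eq_sym (negPf (neq_lift _ _)).
rewrite sumr_const card_Sn -[(_ * D) *+ _]mulr_natl mulKf //; congr (_ * \det _).
by apply/matrixP => i k; rewrite !mxE.
Qed.

Lemma ewedge_det_form (n : nat) (e : n.+1.-tuple 'Hom(V, R^o)) (s : seq nat) :
  all (fun i => i.-1 < n.+1)%N s ->
  ewedge e s = det_form (fun i => tnth e (inord (nth 0%N s i).-1)).
Proof.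
move=> /all_nthP s_le; rewrite ewedgeE; congr det_form; apply/funext => i.
by rewrite (tnth_nth 0) inordK ?s_le.
Qed.

(** * The Hodge star of a monomial *)

Lemma hodge_starD (k l : nat) (E : 'I_(k + l) -> V) (vol : kfun V (k + l))
    (f h : kfun V k) :
  hodge_star E vol (f + h) = hodge_star E vol f + hodge_star E vol h.
Proof.
apply/funext => w; rewrite /hodge_star !fctE -mulrDr -big_split /=.
by congr (_ * _); apply: eq_bigr => I _; rewrite mulrDl.
Qed.

Lemma hodge_starN (k l : nat) (E : 'I_(k + l) -> V) (vol : kfun V (k + l))
    (f : kfun V k) : hodge_star E vol (- f) = - hodge_star E vol f.
Proof.
apply/funext => w; rewrite /hodge_star !fctE -mulrN -sumrN.
by congr (_ * _); apply: eq_bigr => I _; rewrite mulNr.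
Qed.

(** The first [k] columns are permuted by right multiplication with a block-diagonal matrix. *)
Lemma det_form_vcat_perm (k l : nat) (e : 'I_(k + l) -> 'Hom(V, R^o))
    (u : 'I_k -> V) (w : 'I_l -> V) (s : 'S_k) :
  det_form e (vcat (u \o s) w) = (-1) ^+ s * det_form e (vcat u w).
Proof.
pose A := \matrix_(i, j) e i (u j) : 'M[R]_(k + l, k).
pose B := \matrix_(i, j) e i (w j) : 'M[R]_(k + l, l).
have vcatE u' : det_form e (vcat u' w)
    = \det (row_mx (\matrix_(i, j) e i (u' j) : 'M[R]_(k + l, k)) B).
  congr (\det _); apply/matrixP => i j; rewrite !mxE /vcat.
  by case: fintype.split => j'; rewrite mxE.
rewrite !vcatE.
have -> : (\matrix_(i, j) e i ((u \o s) j) : 'M[R]_(k + l, k)) = col_perm s A.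
  by apply/matrixP => i j; rewrite !mxE.
have -> : row_mx (col_perm s A) B
    = row_mx A B *m block_mx (perm_mx s^-1) 0 0 1%:M.
  by rewrite mul_row_block !mulmx0 addr0 add0r mulmx1 -col_permE.
by rewrite det_mulmx det_ublock det1 mulr1 det_perm odd_permV mulrC.
Qed.

(** In the Leibniz formula for the value on $E_I$, the term of [s] survives only for $I = t\circ
    s^{-1}$. Reordering the volume form yields the same sign again, so the $k!$ terms are equal. *)
Lemma hodge_star_det_form (k l : nat) (e : 'I_(k + l) -> 'Hom(V, R^o))
    (E : 'I_(k + l) -> V) (t : 'I_k -> 'I_(k + l)) :
  (forall i j, e i (E j) = (i == j)%:R) ->
  hodge_star E (det_form e) (det_form (e \o t))
  = fun w => det_form e (vcat (E \o t) w).
Proof.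
move=> eE; apply/funext => w; rewrite /hodge_star.
have facN0 : k`!%:R != 0 :> R by rewrite pnatr_eq0 -lt0n fact_gt0.
apply: (mulfI facN0); rewrite mulVKf //.
pose D := det_form e (vcat (E \o t) w).
transitivity (\sum_(s : 'S_k) D); last first.
  by rewrite sumr_const card_Sn mulr_natl.
transitivity (\sum_(s : 'S_k) \sum_(I : {ffun 'I_k -> 'I_(k + l)})
    (I == [ffun i => t ((s^-1)%g i)])%:R
      * ((-1) ^+ s * det_form e (vcat (E \o I) w))).
  rewrite exchange_big /=; apply: eq_bigr => I _.
  rewrite {1}/det_form /determinant mulr_suml; apply: eq_bigr => s _.
  rewrite [RHS]mulrCA -mulrA; congr (_ * (_ * _)).
  case: eqP => [->|IDt].
    by rewrite big1 // => i _; rewrite mxE eE /= ffunE permK eqxx.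
  have [i /negPf tiI|tI] := pickP (fun i => t i != I (s i)).
    by rewrite (bigD1 i) //= mxE eE tiI mul0r.
  case: IDt; apply/ffunP => i; rewrite ffunE.
  by have /negbFE := tI ((s^-1)%g i); rewrite permKV => /eqP ->.
apply: eq_bigr => s _; rewrite (bigD1 [ffun i => t ((s^-1)%g i)]) //= eqxx mul1r.
rewrite big1 ?addr0 => [|I /negPf ->]; last by rewrite mul0r.
have -> : E \o [ffun i => t ((s^-1)%g i)] = (E \o t) \o (s^-1)%g.
  by apply/funext => i; rewrite /= ffunE.
by rewrite det_form_vcat_perm odd_permV signrMK.
Qed.

(** * The dual of the model 3-form *)

Definition hom_coords (n : nat) (e : n.-tuple 'Hom(V, R^o)) (x : V) : nat -> R :=
  fun j => e`_j x.

Definition g2_dual_model (e : 7.-tuple 'Hom(V, R^o)) : kfun V 4 :=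
  g2_dual_sum (fun i j k l => ewedge e [:: i.+1; j.+1; k.+1; l.+1] : kfun V 4).

Lemma ewedge_is_form (n : nat) (e : n.-tuple 'Hom(V, R^o)) (s : seq nat) :
  is_form (ewedge e s).
Proof. by rewrite ewedgeE; apply: det_form_is_form. Qed.

Lemma g2_dual_model_is_form (e : 7.-tuple 'Hom(V, R^o)) :
  is_form (g2_dual_model e).
Proof.
by do !apply: is_formD; try apply: is_formN;
  apply: (ewedge_is_form e [:: _; _; _; _]).
Qed.

Lemma ewedge_det_rows (e : 7.-tuple 'Hom(V, R^o)) (s : seq nat) (w : nat -> V) :
  ewedge e s (fun i => w i)
  = det_rows (size s) (fun i j => hom_coords e (w i) (nth 0%N s j).-1).
Proof.
rewrite ewedgeE /det_form -det_tr; congr (\det _).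
by apply/matrixP => i j; rewrite !mxE.
Qed.

(* The iterated [bump] enumerates the indices other than a, b, c; since a < b < c,
   striking out column a and then b moves b and c to b - 1 and c - 2. *)
Lemma hodge_star_triple (e : 7.-tuple 'Hom(V, R^o)) (E : 'I_7 -> V)
    (a b c : nat) (w : nat -> V) :
  dual_frame e E -> (a < b)%N -> (b < c)%N -> (c < 7)%N ->
  hodge_star (k := 3) (l := 4) E (ewedge e [:: 1; 2; 3; 4; 5; 6; 7])
    (ewedge e [:: a.+1; b.+1; c.+1]) (fun i => w i)
  = (-1) ^+ (a + b.-1 + c.-2) * det_rows 4 (fun i j =>
      hom_coords e (w i) (bump a (bump b.-1 (bump c.-2 j)))).
Proof.
move=> eE ab bc c7; rewrite !ewedge_det_form //; last by apply/and4P; split; lia.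
have -> : (fun i : 'I_7 => tnth e (inord (nth 0%N [:: 1; 2; 3; 4; 5; 6; 7] i).-1))
    = tnth e.
  apply/funext => i; congr (tnth e _); apply/val_inj.
  by case: i => -[|[|[|[|[|[|[|//]]]]]]] lei /=; rewrite inordK.
pose t (i : 'I_3) := inord (nth 0%N [:: a.+1; b.+1; c.+1] i).-1 : 'I_7.
rewrite (hodge_star_det_form (k := 3) (l := 4) t eE).
(* Coordinates of $E_a, E_b, E_c$, which are unit rows to be stripped one by one, then of the four
   arguments. *)
pose r i j : R := if i is k.+3 then hom_coords e (w k) j
  else (j == nth 0%N [:: a; b; c] i)%:R.
transitivity (det_rows 7 r).
  rewrite /det_form -det_tr; congr (\det _); apply/matrixP => i j; rewrite !mxE.
  rewrite /vcat; case: fintype.splitP => k ->; last first.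
    by rewrite /r /hom_coords (tnth_nth 0).
  rewrite /= eE -val_eqE /= /t /r.
  by case: k => -[|[|[|//]]] lek /=; rewrite inordK //; lia.
rewrite (det_rows_delta (a := a)) //; last lia.
rewrite (det_rows_delta (a := b.-1)); [|lia|]; last first.
  by move=> j; rewrite /r /bump /=; congr (nat_of_bool _)%:R; lia.
rewrite (det_rows_delta (a := c.-2)); [|lia|]; last first.
  by move=> j; rewrite /r /bump /=; congr (nat_of_bool _)%:R; lia.
by rewrite !mulrA -!exprD.
Qed.

Lemma hodge_star_g2_model (e : 7.-tuple 'Hom(V, R^o)) (E : 'I_7 -> V) :
  dual_frame e E ->
  hodge_star (k := 3) (l := 4) E (ewedge e [:: 1; 2; 3; 4; 5; 6; 7])
    (g2_model e) = g2_dual_model e.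
Proof.
move=> eE; rewrite /g2_model !(hodge_starD, hodge_starN).
apply/funext => w; rewrite /g2_dual_model /g2_dual_sum !fctE.
have wE : w = fun i => nth 0 [:: w 0; w 1; w 2; w 3] i.
  by apply/funext => -[[|[|[|[|//]]]]] lei; congr w; apply/val_inj.
rewrite wE !(hodge_star_triple (nth 0 _)) // !(ewedge_det_rows _ _ (nth 0 _)).
by rewrite !det_rows4 /bump /=; ring.
Qed.

(** * The square of the contracted dual form *)

(** Each of the three pairings of four indices arises from 8 permutations, and $8/(2!\,2!) = 2$. *)
Lemma wedge_square (f : kfun V 2) (v : nat -> V) :
  let b i j := f (fun k => nth 0 [:: v i; v j] k) in
  (forall i j, b j i = - b i j) ->
  wedge_prod f f (fun k => v k) = 2 * pfaffian4 b 0 1 2 3.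
Proof.
move=> b b_anti; rewrite /wedge_prod /pfaffian4.
pose G (u : 'I_4 -> V) :=
  f (fun a => u (lshift 2 a)) * f (fun a => u (rshift 2 a)).
rewrite -[\sum_s _](_ : alt_sum G (v \o @nat_of_ord _) = _); last first.
  by apply: eq_bigr => t _; rewrite mulrA.
have GE i j k l (u : 'I_0 -> V) :
    G (vcons (v i) (vcons (v j) (vcons (v k) (vcons (v l) u)))) = b i j * b k l.
  have -> : u = fun a => nth 0 [::] a by apply/funext => -[].
  rewrite !vcons_nth /G /b; congr (f _ * f _); apply/funext => a /=.
  by case: a => -[|[|//]].
rewrite !(alt_sum_nth, alt_sum0, big_ord_recl, big_ord0) /= !GE /bump /=.
rewrite (b_anti 0 1) (b_anti 0 2) (b_anti 0 3) (b_anti 1 2) (b_anti 1 3).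
rewrite (b_anti 2 3) (_ : (2`! * 2`!)%N = 4%N) //.
by field; rewrite ?pnatr_eq0.
Qed.

Definition contracted_dual (e : 7.-tuple 'Hom(V, R^o)) (X Y : V) : kfun V 2 :=
  contract_by X (contract_by Y (g2_dual_model e)).

(** The outer contraction inserts [X] first, so the 4-form is evaluated at $(Y, X, v, w)$. *)
Lemma contracted_dualE (e : 7.-tuple 'Hom(V, R^o)) (X Y v w : V) :
  contracted_dual e X Y (fun i => nth 0 [:: v; w] i)
  = g2_dual_sum (wedge22 (bivector (hom_coords e Y) (hom_coords e X))
      (bivector (hom_coords e v) (hom_coords e w))).
Proof.
rewrite /contracted_dual /contract_by !vcons_nth /g2_dual_model /g2_dual_sum.
rewrite !fctE !(ewedge_det_rows _ _ (nth 0 _)) !det_rows4 /wedge22 /bivector /=.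
by ring.
Qed.

Lemma hom_coords_frame (n : nat) (e : n.+1.-tuple 'Hom(V, R^o))
    (E : 'I_n.+1 -> V) (c : nat) :
  dual_frame e E -> (c < n.+1)%N ->
  hom_coords e (E (inord c)) = fun j => (j == c)%:R.
Proof.
move=> eE cn; apply/funext => j; rewrite /hom_coords.
have [jn|nj] := ltnP j n.+1.
  have := eE (inord j) (inord c).
  by rewrite -val_eqE (tnth_nth 0) /= !inordK.
(* For $j > n$ the default covector is 0, and $j \ne c$ because $c \le n$. *)
rewrite nth_default ?size_tuple // lfunE /=.
by case: eqP => // jc; move: cn; rewrite -jc ltnNge nj.
Qed.

(** On the frame the components of [beta] satisfy the hypothesis of [g2_dual_pfaffian];
    [wedge_square] supplies its factor 2. *)
Lemma contracted_dual_square (e : 7.-tuple 'Hom(V, R^o)) (E : 'I_7 -> V)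
    (X Y : V) :
  dual_frame e E ->
  let beta := contracted_dual e X Y in
  g2_dual_sum (fun i j k l => wedge_prod beta beta
    (fun a => nth 0 [seq E (inord c) | c <- [:: i; j; k; l]] a))
  = \sum_(i < 7) \sum_(j < 7)
      bivector (hom_coords e Y) (hom_coords e X) i j ^+ 2.
Proof.
move=> eE beta; pose b i j := beta (fun a => nth 0 [:: E (inord i); E (inord j)] a).
rewrite -(g2_dual_pfaffian (b := b)) => [|c d c7 d7]; last first.
  by rewrite /b /beta contracted_dualE !(hom_coords_frame eE).
have b_anti v w : beta (fun a => nth 0 [:: w; v] a)
    = - beta (fun a => nth 0 [:: v; w] a).
  rewrite /beta !contracted_dualE /g2_dual_sum /wedge22 /bivector.
  by ring.
have sqE i j k l : wedge_prod beta beta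
    (fun a => nth 0 [seq E (inord c) | c <- [:: i; j; k; l]] a)
    = 2 * pfaffian4 b i j k l.
  by rewrite (wedge_square (v := nth 0 _)) // => i' j'; apply: b_anti.
rewrite /g2_dual_sum !sqE; move: (pfaffian4 b) => q.
by ring.
Qed.

(** * From a vanishing bivector to linear dependence *)

(** The covectors recover the coefficients of any combination of the [E i], so these are free, hence
    a basis by dimension. *)
Lemma dual_frame_expand (n : nat) (e : n.-tuple 'Hom(V, R^o)) (E : 'I_n -> V)
    (v : V) :
  \dim {: V} = n -> dual_frame e E -> v = \sum_(i < n) hom_coords e v i *: E i.
Proof.
move=> dimV eE; pose t := [tuple E i | i < n].
have e_sum (k : 'I_n -> R) j : tnth e j (\sum_(i < n) k i *: E i) = k j.
  rewrite linear_sum (bigD1 j) //= linearZ /= eE eqxx big1 ?addr0 => [|i ij].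
    exact: mulr1.
  by rewrite linearZ /= eE eq_sym (negPf ij); apply: mulr0.
have tE (k : 'I_n -> R) : \sum_(i < n) k i *: t`_i = \sum_(i < n) k i *: E i.
  by apply: eq_bigr => i _; rewrite -tnth_nth tnth_mktuple.
have t_free : free t.
  by apply/freeP => k; rewrite tE => k0 i; rewrite -(e_sum k) k0 linear0.
have t_basis : basis_of fullv t by rewrite basisEfree t_free subvf dimV size_tuple /=.
have := coord_basis t_basis (memvf v); rewrite tE => {1}->.
apply: eq_bigr => i _; rewrite /hom_coords -tnth_nth.
by rewrite [in RHS](coord_basis t_basis (memvf v)) tE e_sum.
Qed.

Lemma bivector_eq0_dep (n : nat) (e : n.-tuple 'Hom(V, R^o)) (E : 'I_n -> V)
    (X Y : V) :
  \dim {: V} = n -> dual_frame e E ->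
  (forall i j : 'I_n, bivector (hom_coords e Y) (hom_coords e X) i j = 0) ->
  ~~ free [:: X; Y].
Proof.
move=> dimV eE YX0; rewrite free_cons span_seq1 negb_and negbK.
have expand := dual_frame_expand _ dimV eE.
have [j Yj|Y0] := pickP (fun j : 'I_n => hom_coords e Y j != 0); last first.
  rewrite seq1_free [Y]expand big1 ?eqxx ?orbT // => i _.
  by have /negbFE/eqP -> := Y0 i; rewrite scale0r.
(* From $Y_i X_j = Y_j X_i$ one gets $X_i = (X_j/Y_j) Y_i$ for every $i$. *)
apply/orP; left; apply/vlineP; exists (hom_coords e X j / hom_coords e Y j).
rewrite [LHS]expand [X in _ = _ *: X]expand scaler_sumr.
apply: eq_bigr => i _; rewrite scalerA; congr (_ *: _).
have /eqP := YX0 i j; rewrite subr_eq0 => /eqP YX.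
by apply: (mulfI Yj); rewrite -YX; field.
Qed.
End Forms.

Theorem lemma10 (R : realType) (g : vectType R) (br : g -> g -> g)
    (hbr : is_lie_bracket br) (hdim : \dim {: g} = 7%N)
    (X Y : g) (hX : X != 0) (hY : Y != 0) (hXY : free [:: X; Y])
    (hkappa : forall kappa : kfun g 4, is_form kappa -> closed_form br kappa ->
       wedge_prod (contract_by X (contract_by Y kappa)) (contract_by X (contract_by Y kappa)) = 0) :
  ~ exists phi : kfun g 3, is_G2_structure phi /\ coclosed br phi.
Proof.
move=> [phi [_ [e [E [[_ ->] eE]]]]]; rewrite (hodge_star_g2_model eE) => closed.
have sq0 v : wedge_prod (contracted_dual e X Y) (contracted_dual e X Y) v = 0.
  by rewrite (hkappa _ (g2_dual_model_is_form e) closed).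
have := contracted_dual_square X Y eE.
rewrite /g2_dual_sum !sq0 !addr0 subr0 => /esym sum0.
suff YX0 (i j : 'I_7) : bivector (hom_coords e Y) (hom_coords e X) i j = 0.
  by have := bivector_eq0_dep hdim eE YX0; rewrite hXY.
(* A vanishing sum of real squares vanishes termwise: first each row sum, then each entry. *)
have ge0 (i' j' : 'I_7) :
    0 <= bivector (hom_coords e Y) (hom_coords e X) i' j' ^+ 2 by exact: sqr_ge0.
have row0 := psumr_eq0P (fun i' _ => sumr_ge0 _ (fun j' _ => ge0 i' j')) sum0.
have := psumr_eq0P (fun j' _ => ge0 i j') (row0 i isT).
by move=> /(_ j isT)/eqP; rewrite sqrf_eq0 => /eqP.
Qed.
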